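(* Let $\mathcal C$ be a partial adhesive category with embedding functor $S:\mathcal C\to\mathcal A$ into an adhesive category $\mathcal A$. Let $b:I\to L$ be a monomorphism and $f:L\to G$ a morphism in $\mathcal C$. If the pair $(b,f)$ has an $S$-pushout complement, it is unique up to isomorphism: for any two $S$-pushout complements $I\xrightarrow{c}G'\xrightarrow{g}G$ and $I\xrightarrow{c'}G''\xrightarrow{g'}G$ there is an isomorphism $\phi:G'\to G''$ with $\phi c=c'$ and $g'\phi=g$.
   Context: A category is adhesive if it has pullbacks and pushouts along monomorphisms, and pushouts along monomorphisms are van Kampen squares. A category $\mathcal C$ is partial adhesive if it is a full subcategory of an adhesive category $\mathcal A$ such that the embedding functor $S:\mathcal C\to\mathcal A$ preserves monomorphisms. An $S$-pushout is a pushout in $\mathcal C$ that is preserved by $S$. An $S$-pushout complement of $(b:I\to L,\ f:L\to G)$ consists of an object $G'$ and morphisms $c:I\to G'$, $g:G'\to G$ such that the square $f b=g c$ is an $S$-pushout (of $b$ and $c$). *)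

(* Defs.v *)
Set Implicit Arguments.
Unset Strict Implicit.
Unset Printing Implicit Defensive.

Declare Scope cat_scope.
Delimit Scope cat_scope with cat.

Record category : Type := Category {
  Ob :> Type;
  Hom : Ob -> Ob -> Type;
  idm : forall X : Ob, Hom X X;
  comp : forall X Y Z : Ob, Hom Y Z -> Hom X Y -> Hom X Z;
  comp_idl : forall (X Y : Ob) (f : Hom X Y), comp (idm Y) f = f;
  comp_idr : forall (X Y : Ob) (f : Hom X Y), comp f (idm X) = f;
  comp_assoc : forall (W X Y Z : Ob) (h : Hom Y Z) (g : Hom X Y) (f : Hom W X),
    comp h (comp g f) = comp (comp h g) f
}.

Arguments Hom {c} X Y.
Arguments idm {c} X.
Arguments comp {c X Y Z} g f : rename.

Notation "g '\oc' f" := (comp g f) (at level 40, left associativity) : cat_scope.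
Open Scope cat_scope.

Definition monic (C : category) (X Y : C) (m : Hom X Y) : Prop :=
  forall (T : C) (u v : Hom T X), m \oc u = m \oc v -> u = v.

Definition is_iso (C : category) (X Y : C) (f : Hom X Y) : Prop :=
  exists f' : Hom Y X, f' \oc f = idm X /\ f \oc f' = idm Y.

(* In both predicates below the square is
<<
     X --f--> Y
     |        |
     g        p
     v        v
     Z --q--> W
>>
   with universal cocone (p, q) for a pushout, universal cone (f, g) for a
   pullback. *)
Definition is_pushout (C : category) (X Y Z W : C)
    (f : Hom X Y) (g : Hom X Z) (p : Hom Y W) (q : Hom Z W) : Prop :=
  p \oc f = q \oc g /\
  forall (T : C) (u : Hom Y T) (v : Hom Z T), u \oc f = v \oc g ->
    exists! h : Hom W T, h \oc p = u /\ h \oc q = v.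

Definition is_pullback (C : category) (X Y Z W : C)
    (f : Hom X Y) (g : Hom X Z) (p : Hom Y W) (q : Hom Z W) : Prop :=
  p \oc f = q \oc g /\
  forall (T : C) (u : Hom T Y) (v : Hom T Z), p \oc u = q \oc v ->
    exists! h : Hom T X, f \oc h = u /\ g \oc h = v.

Definition has_pullbacks (C : category) : Prop :=
  forall (Y Z W : C) (p : Hom Y W) (q : Hom Z W),
    exists (X : C) (f : Hom X Y) (g : Hom X Z), is_pullback f g p q.

Definition has_pushouts_along_monos (C : category) : Prop :=
  forall (X Y Z : C) (f : Hom X Y) (g : Hom X Z), monic f ->
    exists (W : C) (p : Hom Y W) (q : Hom Z W), is_pushout f g p q.

(* The cube has the given pushout as bottom face and (f', g', p', q') as top
   face, with vertical edges x, y, z, w.  Its back faces (those over f and g)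
   are assumed to be pullbacks; its front faces are those over p and q. *)
Definition is_van_kampen (C : category) (X Y Z W : C)
    (f : Hom X Y) (g : Hom X Z) (p : Hom Y W) (q : Hom Z W) : Prop :=
  is_pushout f g p q /\
  forall (X' Y' Z' W' : C)
    (f' : Hom X' Y') (g' : Hom X' Z') (p' : Hom Y' W') (q' : Hom Z' W')
    (x : Hom X' X) (y : Hom Y' Y) (z : Hom Z' Z) (w : Hom W' W),
    p' \oc f' = q' \oc g' ->
    y \oc f' = f \oc x -> z \oc g' = g \oc x ->
    w \oc p' = p \oc y -> w \oc q' = q \oc z ->
    is_pullback f' x y f -> is_pullback g' x z g ->
    (is_pushout f' g' p' q' <->
     is_pullback p' y w p /\ is_pullback q' z w q).

(* Squares in which the other leg g is monic are covered by exchanging the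
   two legs. *)
Definition adhesive (C : category) : Prop :=
  has_pullbacks C /\
  has_pushouts_along_monos C /\
  forall (X Y Z W : C)
    (f : Hom X Y) (g : Hom X Z) (p : Hom Y W) (q : Hom Z W),
    monic f -> is_pushout f g p q -> is_van_kampen f g p q.

Record functor (C D : category) : Type := Functor {
  fob :> C -> D;
  fmap : forall X Y : C, Hom X Y -> Hom (fob X) (fob Y);
  fmap_id : forall X : C, fmap (idm X) = idm (fob X);
  fmap_comp : forall (X Y Z : C) (g : Hom Y Z) (f : Hom X Y),
    fmap (g \oc f) = fmap g \oc fmap f
}.

Arguments fmap {C D} f {X Y} _ : rename.

(* S exhibits C as a full subcategory of D: it is injective on objects and
   bijective on hom-sets. *)
Definition full_embedding (C D : category) (S : functor C D) : Prop :=
  (forall X Y : C, S X = S Y -> X = Y) /\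
  (forall (X Y : C) (f g : Hom X Y), fmap S f = fmap S g -> f = g) /\
  (forall (X Y : C) (h : Hom (S X) (S Y)), exists f : Hom X Y, fmap S f = h).

Definition preserves_monos (C D : category) (S : functor C D) : Prop :=
  forall (X Y : C) (m : Hom X Y), monic m -> monic (fmap S m).

Definition partial_adhesive (C A : category) (S : functor C A) : Prop :=
  adhesive A /\ full_embedding S /\ preserves_monos S.

Definition is_S_pushout (C A : category) (S : functor C A) (X Y Z W : C)
    (f : Hom X Y) (g : Hom X Z) (p : Hom Y W) (q : Hom Z W) : Prop :=
  is_pushout f g p q /\ is_pushout (fmap S f) (fmap S g) (fmap S p) (fmap S q).

Definition is_S_pushout_complement (C A : category) (S : functor C A)
    (I L G : C) (b : Hom I L) (f : Hom L G)
    (G' : C) (c : Hom I G') (g : Hom G' G) : Prop :=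
  is_S_pushout S b c f g.

(* Main.v *)
From Corelib Require Import ssreflect.
Require Import Defs.

(**
  In the adhesive category, a pushout along a monomorphism is also a pullback.
  Given two complements [G'], [G''] of [(b, f)], form the pullback [E] of
  [g : G' -> G] and [g' : G'' -> G].  Pulling the first pushout square back
  along [g'] gives a cube whose top face has the identity of [I] as one edge
  and the projection [E -> G''] as the opposite one; by the van Kampen property
  this face is a pushout, so the projection is an isomorphism.  By symmetry so
  is [E -> G'], and the resulting isomorphism [G' -> G''] lifts along the full
  embedding.
*)

Lemma monic_pullback {C : category} {X Y : C} (m : Hom X Y) :
  monic m -> is_pullback (idm X) (idm X) m m.
Proof.
move=> mono_m; split=> // T u v /mono_m <-.
exists u; split=> [|h [<- _]]; by rewrite comp_idl.
Qed.

Lemma pullback_sym {C : category} {X Y Z W : C}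
    (f : Hom X Y) (g : Hom X Z) (p : Hom Y W) (q : Hom Z W) :
  is_pullback f g p q -> is_pullback g f q p.
Proof.
move=> [sq univ]; split=> // T u v uv.
have [h [[hv hu] uniq_h]] := univ T v u (eq_sym uv).
by exists h; split=> // k [ku kv]; apply: uniq_h.
Qed.

Lemma pullback_along_id {C : category} {X Y : C} (f : Hom X Y) :
  is_pullback f (idm X) (idm Y) f.
Proof.
split=> [|T u v]; first by rewrite comp_idl comp_idr.
rewrite comp_idl => ->; exists v.
by split=> [|h [_ <-]]; rewrite comp_idl.
Qed.

Lemma pushout_along_id {C : category} {X Y : C} (f : Hom X Y) :
  is_pushout (idm X) f f (idm Y).
Proof.
split=> [|T u v]; first by rewrite comp_idl comp_idr.
rewrite comp_idr => ->; exists v.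
by split=> [|h [_ <-]]; rewrite comp_idr.
Qed.

(** The cocone [(g, idm Z)] induces a retraction [r] of [q]. Since [q \oc r] agrees with the
    identity on both [p] and [q], [r] is a two-sided inverse. *)
Lemma pushout_of_id_is_iso {C : category} {X Z W : C}
    (g : Hom X Z) (p : Hom X W) (q : Hom Z W) :
  is_pushout (idm X) g p q -> is_iso q.
Proof.
move=> [sq univ].
have [|r [[rp rq] _]] := univ Z g (idm Z); first by rewrite comp_idl comp_idr.
exists r; split=> //.
have [h [_ uniq_h]] := univ W p q sq.
rewrite -(uniq_h (q \oc r)).
- by rewrite -!comp_assoc rp rq comp_idr -sq comp_idr.
- by apply: uniq_h; rewrite !comp_idl.
Qed.

(** Use the van Kampen cube whose top face is the trivial pushout of [idm X] and [g]. Its back face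
    over [f] is a pullback because [f] is monic; its front face over [p] is the given square with
    legs exchanged. *)
Lemma adhesive_pushout_is_pullback {A : category} {X Y Z W : A}
    (f : Hom X Y) (g : Hom X Z) (p : Hom Y W) (q : Hom Z W) :
  adhesive A -> monic f -> is_pushout f g p q -> is_pullback f g p q.
Proof.
move=> [_ [_ vK]] mono_f po.
have [[sq _] cube] := vK _ _ _ _ _ _ _ _ mono_f po.
have [|||||||top _] := cube _ _ _ _ (idm X) g g (idm Z) (idm X) f (idm Z) q.
- by rewrite comp_idl comp_idr.
- by [].
- by rewrite comp_idl comp_idr.
- by rewrite sq.
- by [].
- exact: monic_pullback.
- exact: pullback_along_id.
- have [front _] := top (pushout_along_id g).
  exact: pullback_sym.
Qed.

Lemma complement_pullback_proj_iso {A : category} {I L G D D' E : A}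
    (b : Hom I L) (f : Hom L G)
    (c : Hom I D) (g : Hom D G) (c' : Hom I D') (g' : Hom D' G)
    (d : Hom E D) (d' : Hom E D') :
  adhesive A -> monic b ->
  is_pushout b c f g -> is_pushout b c' f g' -> is_pullback d d' g g' ->
  is_iso d'.
Proof.
move=> adhA mono_b po po' pbE.
have pb' := adhesive_pushout_is_pullback _ _ _ _ adhA mono_b po'.
have [sq _] := po; have [sq' univ'] := pb'; have [sqE univE] := pbE.
have [|e [[de d'e] _]] := univE I c c'; first by rewrite -sq.
(* The mediating map is [v] itself: cancelling the monic [b] gives [c' \oc v = d' \oc u], and then
   [e \oc v = u] because [d] and [d'] are jointly monic. *)
have back : is_pullback e (idm I) d c.
  split=> [|T u v duv]; first by rewrite comp_idr.
  have c'v : c' \oc v = d' \oc u.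
    have [|k [[bk c'k] _]] := univ' T (b \oc v) (d' \oc u).
      by rewrite comp_assoc sq -comp_assoc -duv !comp_assoc sqE.
    by rewrite -c'k (mono_b _ _ _ bk).
  exists v; split=> [|h [_ <-]]; last by rewrite comp_idl.
  split; last by rewrite comp_idl.
  have [|k [_ uniq_k]] := univE T (d \oc u) (d' \oc u).
    by rewrite !comp_assoc sqE.
  rewrite -(uniq_k u) // -(uniq_k (e \oc v)) //.
  by rewrite !comp_assoc de d'e c'v duv.
have [_ [_ vK]] := adhA.
have [_ cube] := vK _ _ _ _ _ _ _ _ mono_b po.
(* The front faces of this cube are the second pushout square, a pullback by [pb'], and the square
   defining [E]. *)
have [|||||||_ top] := cube _ _ _ _ (idm I) e c' d' (idm I) b d g'.
- by rewrite comp_idr.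
- by [].
- by rewrite comp_idr.
- by rewrite sq'.
- by rewrite sqE.
- exact: monic_pullback.
- exact: back.
- apply: (pushout_of_id_is_iso e c').
  by apply: top; split; apply: pullback_sym.
Qed.

Lemma adhesive_pushout_complement_unique {A : category} {I L G D D' : A}
    (b : Hom I L) (f : Hom L G)
    (c : Hom I D) (g : Hom D G) (c' : Hom I D') (g' : Hom D' G) :
  adhesive A -> monic b -> is_pushout b c f g -> is_pushout b c' f g' ->
  exists phi : Hom D D', is_iso phi /\ phi \oc c = c' /\ g' \oc phi = g.
Proof.
move=> adhA mono_b po po'.
have [E [d [d' pbE]]] := proj1 adhA _ _ _ g g'.
have [r' [r'd' d'r']] :=
  complement_pullback_proj_iso _ _ _ _ _ _ _ _ adhA mono_b po po' pbE.
have [r [rd dr]] :=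
  complement_pullback_proj_iso _ _ _ _ _ _ _ _ adhA mono_b po' po
    (pullback_sym _ _ _ _ pbE).
have [sq _] := po; have [sq' _] := po'; have [sqE univE] := pbE.
have [|e [[de d'e] _]] := univE I c c'; first by rewrite -sq.
(* Here [r] inverts [d]. Compatibility with [c] and [c'] holds because both factor through [e]. *)
exists (d' \oc r); split; last split.
- exists (d \oc r'); split.
    by rewrite -comp_assoc (comp_assoc r') r'd' comp_idl.
  by rewrite -comp_assoc (comp_assoc r) rd comp_idl.
- by rewrite -de -comp_assoc (comp_assoc r) rd comp_idl.
- by rewrite comp_assoc -sqE -comp_assoc dr comp_idr.
Qed.

Lemma full_embedding_reflects_iso {C A : category} (S : functor C A)
    {X Y : C} (phi : Hom X Y) :
  full_embedding S -> is_iso (fmap S phi) -> is_iso phi.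
Proof.
move=> [_ [faithful full]] [r [rphi phir]].
have [psi psiE] := full _ _ r.
by exists psi; split; apply: faithful; rewrite fmap_comp fmap_id psiE.
Qed.

Theorem lemma4p4p4 (C A : category) (S : functor C A)
    (hS : partial_adhesive S)
    (I L G : C) (b : Hom I L) (f : Hom L G) (hb : monic b)
    (G' : C) (c : Hom I G') (g : Hom G' G)
    (hc : is_S_pushout_complement S b f c g)
    (G'' : C) (c' : Hom I G'') (g' : Hom G'' G)
    (hc' : is_S_pushout_complement S b f c' g') :
  exists phi : Hom G' G'',
    is_iso phi /\ phi \oc c = c' /\ g' \oc phi = g.
Proof.
have [adhA [embS monoS]] := hS.
have [theta [iso_theta [thetac g'theta]]] :=
  adhesive_pushout_complement_unique _ _ _ _ _ _ adhA (monoS _ _ _ hb)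
    (proj2 hc) (proj2 hc').
have [_ [faithful full]] := embS.
have [phi phiE] := full _ _ theta.
exists phi; split; last split.
- by apply: (full_embedding_reflects_iso S) => //; rewrite phiE.
- by apply: faithful; rewrite fmap_comp phiE.
- by apply: faithful; rewrite fmap_comp phiE.
Qed.
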